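(* Let $G$ be a connected (directed or undirected) graph with a marked vertex (the origin), and let $F_0,F_1$ be distributions on $\mathbb{R}$ with $F_1$ absolutely continuous w.r.t. $F_0$. Suppose there is a probability distribution $\pi$ on the set $\mathcal{P}$ of infinite self-avoiding paths in $G$ starting at the origin which has an exponential intersection tail with parameter $\eta\in(0,1)$. If $\chi^2(F_0,F_1)<\eta^{-1}-1$, then there is no sequence of tests $(T_m)$ for $H_0$ versus $H_{1,m}$ with $\gamma(T_m)\to0$.
   Context: $\mathcal{P}_m$ denotes the set of self-avoiding paths in $G$ starting at the origin and visiting $m$ vertices. Testing problem: under $H_0$ (law $\mathbf{P}_0$) the variables $X_v$, $v$ a vertex, are i.i.d. $F_0$; under $H_{1,m}$ with unknown path $p\in\mathcal{P}_m$ (law $\mathbf{P}_{1,p}$) they are independent with law $F_1$ for $v\in p$ and $F_0$ otherwise. A test is a measurable $\{0,1\}$-valued function of the $X_v$, with minimax risk $\gamma(T_m)=\mathbf{P}_0(T_m=1)+\sup_{p\in\mathcal{P}_m}\mathbf{P}_{1,p}(T_m=0)$. Exponential intersection tail with parameter $\eta$: there is $C>0$ such that if $P,P'$ are independent samples from $\pi$ and $N$ is the number of vertices they have in common, then $\mathbf{P}(N\ge k)\le C\eta^k$ for all $k\ge1$. Pearson $\chi^2$-distance: with $L=dF_1/dF_0$, $\chi^2(F_0,F_1)=\mathrm{Var}_{F_0}(L)$. *)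

(* Defs.v *)
From mathcomp Require Import all_boot all_order all_algebra.
From mathcomp Require Import all_classical all_reals all_analysis.
From Stdlib Require Import Relations.
From Stdlib Require List.
Set Implicit Arguments. Unset Strict Implicit. Unset Printing Implicit Defensive.
Import Order.TTheory GRing.Theory Num.Theory.
Local Open Scope classical_set_scope.
Local Open Scope ring_scope.

(* A (directed) graph on vertex type V is an edge relation E; an undirected
   graph is the special case of a symmetric E. *)

Definition graph_connected (V : Type) (E : V -> V -> Prop) (o : V) : Prop :=
  forall v, clos_refl_trans V (fun a b => E a b \/ E b a) o v.

Definition inf_saw (V : Type) (E : V -> V -> Prop) (o : V) (p : nat -> V) : Prop :=
  [/\ p 0%N = o, injective p & forall n, E (p n) (p n.+1)].

Definition saw_m (V : Type) (E : V -> V -> Prop) (o : V) (m : nat) (p : seq V) : Prop :=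
  [/\ size p = m, (0 < m)%N -> nth o p 0 = o, List.NoDup p &
      forall i, (i.+1 < size p)%N -> E (nth o p i) (nth o p i.+1)].

Definition common_ge (V : Type) (p q : nat -> V) (k : nat) : Prop :=
  exists l : seq V, [/\ size l = k, List.NoDup l &
    forall v, List.In v l -> (exists i, p i = v) /\ (exists j, q j = v)].

(* pi is a probability distribution on paths, realised as a probability on a
   measurable space S together with the map path : S -> paths; P, P' are
   independent samples, i.e. (P, P') has law pi (x) pi on S * S. *)
Definition exp_intersection_tail (R : realType) (V : Type)
  (d : measure_display) (S : measurableType d) (path : S -> nat -> V)
  (pi : probability S R) (eta : R) : Prop :=
  exists C : R, 0 < C /\
    forall k : nat, (1 <= k)%N ->
      let A := [set st : S * S | common_ge (path st.1) (path st.2) k] in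
      measurable A /\ ((pi \x pi)%E A <= (C * eta ^+ k)%:E)%E.

Definition likelihood_ratio (R : realType) (F0 F1 : probability R R) : R -> \bar R :=
  Radon_Nikodym (charge_of_finite_measure F1) F0.

Definition chi2 (R : realType) (F0 F1 : probability R R) : \bar R :=
  let L := likelihood_ratio F0 F1 in
  let EL := (\int[F0]_x L x)%E in
  (\int[F0]_x ((L x - EL) * (L x - EL)))%E.

Definition indep_with_laws (R : realType) (V : Type)
  (d : measure_display) (Om : measurableType d) (P : probability Om R)
  (X : V -> Om -> R) (F : V -> probability R R) : Prop :=
  forall (s : seq V) (B : V -> set R), List.NoDup s -> (forall v, measurable (B v)) ->
    P (\bigcap_(v in [set v | List.In v s]) (X v @^-1` B v)) =
    (\prod_(v <- s) fine (F v (B v)))%:E.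

Definition sigmaX (R : realType) (V : Type) (Om : Type) (X : V -> Om -> R) : set (set Om) :=
  <<s [set A | exists v (B : set R), measurable B /\ A = X v @^-1` B] >>.

Definition is_test (R : realType) (V : Type) (Om : Type) (X : V -> Om -> R)
  (T : Om -> bool) : Prop :=
  sigmaX X (T @^-1` [set true]).

Definition risk (R : realType) (V : Type) (E : V -> V -> Prop) (o : V)
  (d : measure_display) (Om : measurableType d)
  (P0 : probability Om R) (P1 : seq V -> probability Om R) (m : nat) (T : Om -> bool)
  : \bar R :=
  (P0 (T @^-1` [set true]) +
   ereal_sup [set P1 p (T @^-1` [set false]) | p in saw_m E o m])%E.

(* Main.v *)
(* The likelihood ratio of a path [p] is [L_p = prod_(v in p) L(X_v)], and
   independence gives [E_0 (L_p L_q) = rho ^ |p cap q|] with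
   [rho = 1 + chi2 F0 F1], where [rho * eta < 1]. The classical second-moment
   argument would mix the laws of the paths with respect to [pi], but nothing
   makes the events "v lies on the path" measurable. Instead one selects, for
   each [m], finitely many paths [p_1, ..., p_n] whose average overlap weight
   [n^-2 sum_(i, j) rho ^ |p_i cap p_j|] is bounded independently of [m]: the
   pairs [i != j] cost no more than their expectation under [pi x pi], which
   the exponential tail bounds by a constant [K], and the diagonal contributes
   [rho ^ m / n <= 1] for large [n]. The uniform mixture over [p_1, ..., p_n]
   then has likelihood ratio bounded in [L^2(P_0)], so its mass on the rejection
   region cannot tend to 1 while the mass under [P_0] tends to 0. *)

Require Import Defs.
From mathcomp Require Import all_boot all_order all_algebra.
From mathcomp Require Import all_classical all_reals all_analysis measurable_realfun.
From mathcomp Require Import ring lra.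
Import Order.TTheory GRing.Theory Num.Theory.
Local Open Scope classical_set_scope.
Local Open Scope ring_scope.

Import HBNNSimple.

(** * Integrals of products of functions of independent variables *)

(** The hypothesis on preimages says that [X] pushes the measure with density [Z] with respect to
    [mu] forward to [c] times [nu]. It is the desired formula for indicators; linearity and monotone
    convergence along simple functions extend it to [f]. *)
Lemma ge0_integral_comp_mul (R : realType) (d d' : measure_display)
  (T : measurableType d) (T' : measurableType d')
  (mu : {measure set T -> \bar R}) (nu : {measure set T' -> \bar R})
  (X : T -> T') (Z : T -> R) (c : R) (f : T' -> R) :
  measurable_fun setT X -> measurable_fun setT Z -> (forall x, 0 <= Z x) ->
  0 <= c ->
  (forall B, measurable B ->
     (\int[mu]_(x in X @^-1` B) (Z x)%:E = c%:E * nu B)%E) ->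
  measurable_fun setT f -> (forall y, 0 <= f y) ->
  (\int[mu]_x (f (X x) * Z x)%:E = c%:E * \int[nu]_y (f y)%:E)%E.
Proof.
move=> mX mZ Z0 c0 XZ mf f0.
have mf' : measurable_fun setT (fun y => (f y)%:E) by exact/measurable_EFinP.
pose h := nnsfun_approx measurableT mf'.
have mhX n : measurable_fun setT (fun x => h n (X x)) by exact: measurableT_comp.
have hf y : (h n y)%:E @[n --> \oo] --> (f y)%:E.
  by apply: cvg_nnsfun_approx => // z _; rewrite lee_fin.
have ndh y : {homo (fun n => h n y) : m n / (m <= n)%N >-> m <= n}.
  by move=> m n mn; exact/lefP/nd_nnsfun_approx.
have lhs : (\int[mu]_x (h n (X x) * Z x)%:E @[n --> \oo]
    --> \int[mu]_x (f (X x) * Z x)%:E)%E.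
  have := @cvg_monotone_convergence _ _ _ mu setT measurableT
    (fun n x => (h n (X x) * Z x)%:E).
  have -> : (fun x => limn (fun n => (h n (X x) * Z x)%:E)) =
      (fun x => (f (X x) * Z x)%:E).
    apply/funext => x; apply/cvg_lim => //.
    under eq_fun do rewrite EFinM.
    by rewrite EFinM; apply: cvgeZr.
  apply.
  - by move=> n; apply/measurable_EFinP; exact: measurable_funM.
  - by move=> n x _; rewrite lee_fin mulr_ge0.
  - by move=> x _ m n mn; rewrite lee_fin ler_wpM2r// ndh.
have rhs : (c%:E * \int[nu]_y (h n y)%:E @[n --> \oo]
    --> c%:E * \int[nu]_y (f y)%:E)%E.
  apply: cvgeZl => //.
  have := @cvg_monotone_convergence _ _ _ nu setT measurableT
    (fun n y => (h n y)%:E).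
  have -> : (fun y => limn (fun n => (h n y)%:E)) = EFin \o f.
    by apply/funext => y; apply/cvg_lim.
  apply.
  - by move=> n; apply/measurable_EFinP.
  - by move=> n x _; rewrite lee_fin.
  - by move=> x _ m n mn; rewrite lee_fin ndh.
apply: (cvg_unique _ lhs); first exact: ereal_hausdorff.
rewrite (_ : (fun n => _) = fun n => (c%:E * \int[nu]_y (h n y)%:E)%E)//.
apply/funext => n.
(* For a fixed simple function both sides split over its level sets, and on each of them the
   hypothesis on preimages applies. *)
have fimE y : (h n y)%:E =
    (\sum_(r \in range (h n)) (r * \1_(h n @^-1` [set r]) y)%:E)%E.
  by rewrite [in LHS]fimfunE -fsumEFin.
have rge0 r : r \in range (h n) -> 0 <= r.
  by rewrite inE => -[y _ <-].
transitivity (\int[mu]_x (\sum_(r \in range (h n))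
    ((r * \1_(h n @^-1` [set r]) (X x))%:E * (Z x)%:E))%E)%E.
  apply: eq_integral => x _; rewrite EFinM fimE ge0_mule_fsuml// => r.
  exact: nnfun_muleindic_ge0.
rewrite ge0_integral_fsum//; last 2 first.
- move=> r; apply: emeasurable_funM; last exact/measurable_EFinP.
  apply/measurable_EFinP; apply: measurable_funM => //.
  by apply: measurableT_comp.
- by move=> r x _; rewrite mule_ge0 ?lee_fin//; exact: nnfun_muleindic_ge0.
under [in RHS]eq_integral do rewrite fimE.
rewrite ge0_integral_fsum//; last 2 first.
- by move=> r; apply/measurable_EFinP; exact: measurable_funM.
- by move=> r x _; exact: nnfun_muleindic_ge0.
rewrite ge0_mule_fsumr; last first.
  by move=> r; apply: integral_ge0 => y _; exact: nnfun_muleindic_ge0.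
apply: eq_fsbigr => r rh; have r0 := rge0 _ rh.
have mr : measurable (h n @^-1` [set r]) by exact: measurable_sfunP.
under [in RHS]eq_integral do rewrite EFinM.
rewrite integralZl_indic_nnsfun// integral_indic// setIT.
under eq_integral do rewrite EFinM -muleA.
rewrite ge0_integralZl//.
- rewrite muleCA -XZ//; congr (_ * _)%E.
  rewrite [in RHS]integral_mkcond; apply: eq_integral => x _.
  rewrite /patch indicE (_ : (x \in X @^-1` _) = (X x \in h n @^-1` [set r]))//.
  by case: ifP => _; rewrite ?mul1e ?mul0e.
- apply: emeasurable_funM; last exact/measurable_EFinP.
  by apply/measurable_EFinP; exact: measurableT_comp.
- by move=> x _; rewrite mule_ge0 ?lee_fin.
Qed.

Lemma bigcap_seq_cons (I : eqType) (T : Type) (a : I) (s : seq I)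
  (G : I -> set T) :
  \bigcap_(i in [set` a :: s]) G i = G a `&` \bigcap_(i in [set` s]) G i.
Proof.
rewrite -bigcap_setU1; congr (\bigcap_(i in _) G i).
apply/seteqP; split=> i /=.
  by rewrite inE => /orP[/eqP ->|]; [left|right].
by rewrite inE => -[->|->]; rewrite ?eqxx ?orbT.
Qed.

Section independent_products.
Context (R : realType) (V : eqType) (d : measure_display)
  (Om : measurableType d) (P : probability Om R) (X : V -> Om -> R)
  (F : V -> probability R R).
Hypothesis mX : forall v, measurable_fun setT (X v).
Hypothesis XF : forall (s : seq V) (B : V -> set R), uniq s ->
  (forall v, measurable (B v)) ->
  P (\bigcap_(v in [set` s]) (X v @^-1` B v)) =
  (\prod_(v <- s) fine (F v (B v)))%:E.

Lemma measurable_cylinder (s : seq V) (B : V -> set R) :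
  (forall v, measurable (B v)) ->
  measurable (\bigcap_(v in [set` s]) (X v @^-1` B v)).
Proof.
move=> mB; elim: s => [|a s ih]; first by rewrite set_nil bigcap_set0.
rewrite bigcap_seq_cons; apply: measurableI => //.
by rewrite -[X in measurable X]setTI; exact: mX.
Qed.

Lemma measurable_prod_comp (s : seq V) (f : V -> R -> R) :
  (forall v, measurable_fun setT (f v)) ->
  measurable_fun setT (fun x => \prod_(v <- s) f v (X v x)).
Proof.
move=> mf; apply: measurable_prod => v _.
exact: measurableT_comp.
Qed.

(** The cylinder over [t] makes the induction on [s] work. To integrate out the factor at [a], one
    needs the joint behaviour of an event on [X a] with the remaining factors, and such an event is
    just one more coordinate of the cylinder. *)
Lemma integral_prod_cylinder (f : V -> R -> R) (e : V -> R) (s t : seq V)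
  (B : V -> set R) :
  (forall v, measurable_fun setT (f v)) -> (forall v y, 0 <= f v y) ->
  (forall v, \int[F v]_y (f v y)%:E = (e v)%:E)%E ->
  uniq (s ++ t) -> (forall v, measurable (B v)) ->
  (\int[P]_(x in \bigcap_(v in [set` t]) (X v @^-1` B v))
     (\prod_(v <- s) f v (X v x))%:E =
   (\prod_(v <- s) e v * \prod_(v <- t) fine (F v (B v)))%:E)%E.
Proof.
move=> mf f0 fe.
have e0 v : 0 <= e v by rewrite -lee_fin -fe; apply: integral_ge0 => y _; rewrite lee_fin.
elim: s t B => [|a s ih] t B ust mB.
  rewrite big_nil mul1r -XF//.
  under eq_integral do rewrite big_nil.
  by rewrite integral_cst ?mul1e//; exact: measurable_cylinder.
set A := \bigcap_(v in _) _.
have mA : measurable A by exact: measurable_cylinder.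
have /= /andP[ast ust'] := ust.
(* [Z] gathers everything that does not involve the coordinate [a]; [c] will be its integral. *)
pose Z x : R := \prod_(v <- s) f v (X v x) * \1_A x.
have mZ : measurable_fun setT Z.
  by apply: measurable_funM => //; exact: measurable_prod_comp.
have Z0 x : 0 <= Z x by rewrite mulr_ge0// prodr_ge0.
set c := \prod_(v <- s) e v * \prod_(v <- t) fine (F v (B v)).
have c0 : 0 <= c by rewrite mulr_ge0// prodr_ge0// => v _; rewrite fine_ge0.
rewrite big_cons -mulrA -/c mulrC EFinM -fe.
rewrite -(@ge0_integral_comp_mul _ _ _ _ _ P (F a) (X a) Z)//.
  rewrite [LHS]integral_mkcond; apply: eq_integral => x _.
  rewrite /patch /Z indicE big_cons.
  by case: ifP => _; rewrite ?mulr1// !mulr0.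
move=> C mC.
(* Since [a] is not in [t], prescribing [C] at [a] leaves the constraints on [t] intact, so the
   induction hypothesis applies to [a :: t]. *)
pose B' v := if v == a then C else B v.
have mB' v : measurable (B' v) by rewrite /B'; case: ifP.
have uas : uniq (s ++ a :: t) by rewrite -cat1s uniq_catCA.
have at' : a \notin t by move: ast; rewrite mem_cat negb_or => /andP[].
have BB' v : v \in t -> B' v = B v.
  by move=> vt; rewrite /B'; case: eqP => // va; rewrite -va vt in at'.
have := ih (a :: t) B' uas mB'.
rewrite big_cons {2}/B' eqxx mulrCA (_ : \prod_(v <- s) _ * _ = c); last first.
  rewrite /c; congr (_ * _); apply: eq_big_seq => v vt.
  by rewrite BB'.
rewrite mulrC EFinM fineK ?fin_num_measure// => <-.
rewrite bigcap_seq_cons (_ : \bigcap_(v in _) _ = A); last first.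
  by apply: eq_bigcapr => v vt; rewrite BB'.
rewrite [RHS]integral_mkcond [LHS]integral_mkcond.
apply: eq_integral => x _.
rewrite /patch /Z indicE in_setI /B' eqxx.
by case: (x \in _) => //=; case: (x \in A); rewrite ?mulr1 ?mulr0.
Qed.

Lemma integral_prod_indep (f : V -> R -> R) (e : V -> R) (s : seq V) :
  (forall v, measurable_fun setT (f v)) -> (forall v y, 0 <= f v y) ->
  (forall v, \int[F v]_y (f v y)%:E = (e v)%:E)%E -> uniq s ->
  (\int[P]_x (\prod_(v <- s) f v (X v x))%:E = (\prod_(v <- s) e v)%:E)%E.
Proof.
move=> mf f0 fe us.
have := @integral_prod_cylinder f e s [::] (fun=> setT) mf f0 fe.
by rewrite set_nil bigcap_set0 big_nil mulr1 cats0; exact.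
Qed.

End independent_products.

(** * The likelihood ratio of a path *)

Lemma prod_uniq_sub (R : comNzRingType) (I : eqType) (p u : seq I) (a : I -> R) :
  uniq p -> uniq u -> {subset p <= u} ->
  \prod_(i <- u) (if i \in p then a i else 1) = \prod_(i <- p) a i.
Proof.
move=> up uu pu; rewrite -big_mkcond -big_filter; apply: perm_big.
apply: uniq_perm => //; first exact: filter_uniq.
by move=> i; rewrite mem_filter; case: (boolP (i \in p)) => //= /pu.
Qed.

Lemma prod_indic_cylinder (R : realType) (I : eqType) (T U : Type)
  (X : I -> T -> U) (B : I -> set U) (s : seq I) (x : T) :
  \prod_(i <- s) \1_(B i) (X i x) =
  \1_(\bigcap_(i in [set` s]) (X i @^-1` B i)) x :> R.
Proof.
elim: s => [|a s ih].
  by rewrite big_nil set_nil bigcap_set0 indicT.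
rewrite big_cons ih bigcap_seq_cons !indicE in_setI.
by rewrite -mulnb natrM.
Qed.

Lemma cylinder_widen (I : eqType) (T U : Type) (X : I -> T -> U)
  (B : I -> set U) (s u : seq I) : {subset s <= u} ->
  \bigcap_(i in [set` s]) (X i @^-1` B i) =
  \bigcap_(i in [set` u]) (X i @^-1` (if i \in s then B i else setT)).
Proof.
move=> su; apply/seteqP; split=> x Bx i /= iu.
  by case: ifP => // si; exact: Bx.
by have := Bx i (su _ iu); rewrite iu.
Qed.

Section likelihood.
Context (R : realType) (V : eqType) (d : measure_display)
  (Om : measurableType d) (P0 P1 : probability Om R) (X : V -> Om -> R)
  (F0 F1 : probability R R) (p : seq V) (l : R -> R).
Hypothesis mX : forall v, measurable_fun setT (X v).
Hypothesis XF0 : forall (s : seq V) (B : V -> set R), uniq s ->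
  (forall v, measurable (B v)) ->
  P0 (\bigcap_(v in [set` s]) (X v @^-1` B v)) =
  (\prod_(v <- s) fine (F0 (B v)))%:E.
Hypothesis XF1 : forall (s : seq V) (B : V -> set R), uniq s ->
  (forall v, measurable (B v)) ->
  P1 (\bigcap_(v in [set` s]) (X v @^-1` B v)) =
  (\prod_(v <- s) fine ((if v \in p then F1 else F0) (B v)))%:E.
Hypothesis up : uniq p.
Hypothesis ml : measurable_fun setT l.
Hypothesis l0 : forall y, 0 <= l y.
Hypothesis lE : forall B, measurable B -> (\int[F0]_(y in B) (l y)%:E = F1 B)%E.

Let Lp (x : Om) : R := \prod_(v <- p) l (X v x).

Let mLp : measurable_fun setT Lp.
Proof. exact: (@measurable_prod_comp _ _ _ _ _ mX p (fun=> l)). Qed.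

Let Lp0 x : 0 <= Lp x. Proof. exact: prodr_ge0. Qed.

(** Over the union [u] of [p] and [s], density and indicator together form a product of functions of
    single coordinates. Independence under [P0] integrates each factor separately, giving the
    [F1]-mass on [p] and the [F0]-mass off [p]. *)
Lemma likelihood_cylinder (s : seq V) (B : V -> set R) :
  (forall v, measurable (B v)) ->
  let A := \bigcap_(v in [set` s]) (X v @^-1` B v) in
  P1 A = (\int[P0]_(x in A) (Lp x)%:E)%E.
Proof.
move=> mB A; pose u := undup (p ++ s).
have uu : uniq u by exact: undup_uniq.
have su : {subset s <= u} by move=> v vs; rewrite mem_undup mem_cat vs orbT.
have pu : {subset p <= u} by move=> v vp; rewrite mem_undup mem_cat vp.
pose B' v := if v \in s then B v else setT.
have mB' v : measurable (B' v) by rewrite /B'; case: ifP.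
have AE : A = \bigcap_(v in [set` u]) (X v @^-1` B' v).
  exact: cylinder_widen.
rewrite {1}AE XF1//.
pose f v y : R := (if v \in p then l y else 1) * \1_(B' v) y.
rewrite -(@integral_prod_indep _ _ _ _ P0 X (fun=> F0) mX XF0 f)//.
- rewrite [RHS]integral_mkcond; apply: eq_integral => x _.
  rewrite /patch /f big_split/= (prod_uniq_sub _ _ p u (fun v => l (X v x)))//.
  rewrite prod_indic_cylinder -AE indicE.
  by case: (x \in A); rewrite ?mulr1 ?mulr0.
- by move=> v; apply: measurable_funM => //; case: (v \in p).
- by move=> v y; rewrite mulr_ge0//; case: ifP.
- move=> v; rewrite fineK ?fin_num_measure//.
  transitivity (\int[F0]_(y in B' v) (if v \in p then l y else 1)%:E)%E.
    rewrite [RHS]integral_mkcond; apply: eq_integral => y _.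
    rewrite /patch /f indicE.
    by case: (y \in B' v); rewrite ?mulr1 ?mulr0.
  case: ifP => _; first exact: lE.
  by rewrite integral_cst ?mul1e.
Qed.

(** Dynkin's argument: cylinders are closed under intersection and generate [sigmaX X], and the sets
    with the claimed property form a Dynkin system. Measurability is carried along because a test is
    only known to be measurable with respect to [sigmaX X]. *)
Lemma likelihood_sigmaX (A : set Om) : sigmaX X A ->
  measurable A /\ P1 A = (\int[P0]_(x in A) (Lp x)%:E)%E.
Proof.
pose G : set (set Om) := [set A | exists (s : seq V) (B : V -> set R),
  (forall v, measurable (B v)) /\
  A = \bigcap_(v in [set` s]) (X v @^-1` B v)].
have GI : setI_closed G.
  move=> _ _ [s [B [mB ->]]] [t [C [mC ->]]].
  exists (undup (s ++ t)), (fun v => (if v \in s then B v else setT) `&`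
    (if v \in t then C v else setT)); split.
    by move=> v; apply: measurableI; case: ifP.
  rewrite (@cylinder_widen _ _ _ _ _ s (undup (s ++ t))); last first.
    by move=> v vs; rewrite mem_undup mem_cat vs.
  rewrite (@cylinder_widen _ _ _ _ _ t (undup (s ++ t))); last first.
    by move=> v vs; rewrite mem_undup mem_cat vs orbT.
  by rewrite -bigcapI; apply: eq_bigcapr => v _; rewrite preimage_setI.
have mLpE D : measurable_fun D (fun x => (Lp x)%:E).
  by apply/measurable_funTS; exact/measurable_EFinP.
have intT : (\int[P0]_x (Lp x)%:E = 1)%E.
  have := @likelihood_cylinder [::] (fun=> setT) (fun=> measurableT).
  by rewrite /= set_nil bigcap_set0 => <-; rewrite probability_setT.
suff : <<d G >> `<=` [set A | measurable A /\
    P1 A = (\int[P0]_(x in A) (Lp x)%:E)%E].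
  rewrite setI_closed_g_dynkin_g_sigma_algebra// => GD XA; apply: GD.
  move: A XA; apply: smallest_sub; first exact: smallest_sigma_algebra.
  move=> _ [v [B [mB ->]]]; apply: sub_sigma_algebra.
  exists [:: v], (fun=> B); split => //.
  by rewrite set_cons1 bigcap_set1.
apply: smallest_sub; last first.
  move=> _ [s [B [mB ->]]]; split; first exact: measurable_cylinder.
  exact: likelihood_cylinder.
split.
- by split => //; rewrite intT probability_setT.
- move=> D [mD PD]; split; first exact: measurableC.
  rewrite probability_setC// PD.
  have mCD := measurableC mD.
  have : (\int[P0]_(x in D `|` ~` D) (Lp x)%:E = 1)%E by rewrite setUv intT.
  rewrite ge0_integral_setU//; last 2 first.
  - by move=> x _; rewrite lee_fin.
  - by rewrite disj_set2E setICr.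
  have PDfin : P1 D \is a fin_num by exact: fin_num_measure.
  move=> <-; rewrite addeAC subee ?add0e//.
  by rewrite -PD.
- move=> D tD DP; split; first by apply: bigcup_measurable => k _; exact: (DP k).1.
  rewrite ge0_integral_bigcup//; last 2 first.
  - by move=> k; exact: (DP k).1.
  - by move=> x _; rewrite lee_fin.
  rewrite measure_semi_bigcup//; last 2 first.
  - by move=> k; exact: (DP k).1.
  - by apply: bigcup_measurable => k _; exact: (DP k).1.
  by apply: eq_eseriesr => k _; exact: (DP k).2.
Qed.

End likelihood.

(** * Second moments of likelihood ratios *)

Section second_moment.
Context (R : realType) (V : eqType) (d : measure_display)
  (Om : measurableType d) (P0 : probability Om R) (X : V -> Om -> R)
  (F0 : probability R R) (l : R -> R) (rho : R).
Hypothesis mX : forall v, measurable_fun setT (X v).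
Hypothesis XF0 : forall (s : seq V) (B : V -> set R), uniq s ->
  (forall v, measurable (B v)) ->
  P0 (\bigcap_(v in [set` s]) (X v @^-1` B v)) =
  (\prod_(v <- s) fine (F0 (B v)))%:E.
Hypothesis ml : measurable_fun setT l.
Hypothesis l0 : forall y, 0 <= l y.
Hypothesis l1 : (\int[F0]_y (l y)%:E = 1)%E.
Hypothesis l2 : (\int[F0]_y (l y ^+ 2)%:E = rho%:E)%E.

Let L (p : seq V) (x : Om) : R := \prod_(v <- p) l (X v x).

Let mL p : measurable_fun setT (L p).
Proof. exact: (@measurable_prod_comp _ _ _ _ _ mX p (fun=> l)). Qed.

Let L0 p x : 0 <= L p x. Proof. exact: prodr_ge0. Qed.

(** A vertex on both paths contributes the second moment [rho] of [l]; a vertex on only one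
    contributes its mean, which is 1. *)
Lemma integral_likelihood_mul (p q : seq V) : uniq p -> uniq q ->
  (\int[P0]_x (L p x * L q x)%:E = (rho ^+ count [in q] p)%:E)%E.
Proof.
move=> up uq; pose u := undup (p ++ q).
have uu : uniq u by exact: undup_uniq.
have pu : {subset p <= u} by move=> v vp; rewrite mem_undup mem_cat vp.
have qu : {subset q <= u} by move=> v vq; rewrite mem_undup mem_cat vq orbT.
pose f v y : R := (if v \in p then l y else 1) * (if v \in q then l y else 1).
pose pq := [seq v <- p | v \in q].
have upq : uniq pq by exact: filter_uniq.
have pqu : {subset pq <= u} by move=> v; rewrite mem_filter => /andP[_ /pu].
transitivity (\int[P0]_x (\prod_(v <- u) f v (X v x))%:E)%E.
  apply: eq_integral => x _; rewrite /f big_split/=.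
  by rewrite (prod_uniq_sub _ _ p u (fun v => l (X v x)))//
             (prod_uniq_sub _ _ q u (fun v => l (X v x))).
rewrite (@integral_prod_indep _ _ _ _ P0 X (fun=> F0) mX XF0 f
  (fun v => if v \in pq then rho else 1))//.
- rewrite (prod_uniq_sub _ _ pq u (fun=> rho))// big_const_seq.
  by rewrite count_predT size_filter iter_mulr_1.
- by move=> v; apply: measurable_funM; [case: (v \in p)|case: (v \in q)].
- by move=> v y; rewrite mulr_ge0//; case: ifP.
- move=> v; rewrite mem_filter /f andbC.
  case: (v \in p); case: (v \in q) => /=.
  + by rewrite -l2; apply: eq_integral => y _; rewrite expr2.
  + by rewrite -l1; apply: eq_integral => y _; rewrite mulr1.
  + by rewrite -l1; apply: eq_integral => y _; rewrite mul1r.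
  + by rewrite mulr1 integral_cst//= mul1e probability_setT.
Qed.

(* Integrated form of [S <= a / 2 + S ^ 2 / (2 a)], where [S] is the sum of the
   likelihood ratios of the paths in [ps]. *)
Lemma sum_integral_likelihood_le (A : set Om) (ps : seq (seq V)) (a : R) :
  measurable A -> 0 < a -> all uniq ps ->
  (\sum_(p <- ps) \int[P0]_(x in A) (L p x)%:E <=
   (a / 2)%:E * P0 A +
   ((2 * a)^-1 * \sum_(p <- ps) \sum_(q <- ps) rho ^+ count [in q] p)%:E)%E.
Proof.
move=> mA a0 /allP ups.
pose S x := \sum_(p <- ps) L p x.
have mS : measurable_fun setT S by apply: measurable_sum.
have S2 : (\int[P0]_x (S x ^+ 2)%:E =
    (\sum_(p <- ps) \sum_(q <- ps) rho ^+ count [in q] p)%:E)%E.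
  transitivity (\int[P0]_x
      \sum_(p <- ps) \sum_(q <- ps) (L p x * L q x)%:E)%E.
    apply: eq_integral => x _; rewrite expr2 /S mulr_suml -sumEFin.
    by apply: eq_bigr => p _; rewrite mulr_sumr -sumEFin.
  rewrite ge0_integral_sum//; last 2 first.
  - move=> p; apply: emeasurable_sum => q.
    by apply/measurable_EFinP; exact: measurable_funM.
  - by move=> p x _; apply: sume_ge0 => q _; rewrite lee_fin mulr_ge0.
  rewrite -sumEFin big_seq [RHS]big_seq; apply: eq_bigr => p pps.
  rewrite ge0_integral_sum//; last 2 first.
  - by move=> q; apply/measurable_EFinP; exact: measurable_funM.
  - by move=> q x _; rewrite lee_fin mulr_ge0.
  rewrite -sumEFin big_seq [RHS]big_seq; apply: eq_bigr => q qps.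
  by apply: integral_likelihood_mul; exact: ups.
rewrite -ge0_integral_sum//; last 2 first.
- by move=> p; apply/measurable_funTS; exact/measurable_EFinP.
- by move=> p x _; rewrite lee_fin.
rewrite [X in (_ + X)%E]EFinM -S2 -(integral_cst P0 mA).
rewrite -ge0_integralZl//; last 3 first.
- by apply/measurable_EFinP; exact: measurable_funX.
- by move=> x _; rewrite lee_fin sqr_ge0.
- by rewrite lee_fin invr_ge0 mulr_ge0// ltW.
apply: (@le_trans _ _ (\int[P0]_(x in A) ((a / 2)%:E +
    (2 * a)^-1%:E * (S x ^+ 2)%:E))%E).
  apply: ge0_le_integral => //.
  - by move=> x _; apply: sume_ge0 => p _; rewrite lee_fin.
  - apply: emeasurable_sum => p; apply/measurable_funTS.
    exact/measurable_EFinP.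
  - by apply/measurable_funTS/emeasurable_funD => //;
      apply/measurable_EFinP; apply: measurable_funM => //; exact: measurable_funX.
  - move=> x _; rewrite sumEFin -EFinM -EFinD lee_fin -/(S x) -subr_ge0.
    rewrite (_ : _ - _ = (2 * a)^-1 * (S x - a) ^+ 2).
      by rewrite mulr_ge0 ?sqr_ge0// invr_ge0 mulr_ge0// ltW.
    by field; rewrite gt_eqF.
rewrite ge0_integralD//; last 3 first.
- by move=> x _; rewrite lee_fin divr_ge0// ltW.
- move=> x _; rewrite -EFinM lee_fin mulr_ge0 ?sqr_ge0// invr_ge0 mulr_ge0//.
  exact: ltW.
- apply/measurable_funTS/measurable_EFinP; apply: measurable_funM => //.
  exact: measurable_funX.
(* The quadratic term is nonnegative, so its integral over [A] is at most the one over the whole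
   space, where the second moment is known. *)
rewrite leeD2l// ge0_subset_integral//.
- by apply/measurable_EFinP; apply: measurable_funM => //; exact: measurable_funX.
- move=> x _; rewrite -EFinM lee_fin mulr_ge0 ?sqr_ge0// invr_ge0 mulr_ge0//.
  exact: ltW.
Qed.

End second_moment.

(** * Choosing finitely many sample points with a small pair sum *)

(** If [f] exceeded its mean [c] everywhere, then [f - c] would be positive with integral 0, hence
    zero almost everywhere, which a measure of total mass 1 forbids. *)
Lemma exists_le_integral (R : realType) (d : measure_display)
  (T : measurableType d) (P : probability T R) (f : T -> \bar R) :
  measurable_fun setT f -> (forall x, 0 <= f x)%E ->
  exists x, (f x <= \int[P]_y f y)%E.
Proof.
move=> mf f0; apply: contrapT => /forallNP fgt.
have {}fgt x : (\int[P]_y f y < f x)%E by rewrite ltNge; exact/negP.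
(* A strict inequality at a single point already makes the mean finite, so that it can be
   subtracted. *)
have fin : (\int[P]_y f y)%E \is a fin_num.
  have T0 : [set: T] !=set0.
    apply/set0P/eqP => T0; have := @probability_setT _ _ _ P.
    by rewrite T0 measure0 => /eqP; rewrite eq_sym onee_eq0.
  case: T0 => x _; rewrite ge0_fin_numE ?integral_ge0//.
  by rewrite (lt_le_trans (fgt x))// leey.
have [c cE] : exists c, c = (\int[P]_y f y)%E by eexists.
rewrite -cE in fgt fin.
have c0 : (0 <= c)%E by rewrite cE; exact: integral_ge0.
pose g x := (f x - c)%E.
have g0 x : (0 < g x)%E by rewrite sube_gt0.
have mg : measurable_fun setT g by exact: emeasurable_funB.
have ig : (\int[P]_x g x = 0)%E.
  have ci : c = (\int[P]_x g x + c)%E.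
    transitivity (\int[P]_x (g x + c))%E.
      by rewrite cE; apply: eq_integral => x _; rewrite -cE subeK.
    rewrite ge0_integralD//; last by move=> x _; exact: ltW.
    by rewrite integral_cst//= probability_setT mule1.
  by rewrite -[LHS](addeK _ fin) -ci subee.
have : (\int[P]_x `|g x| = 0)%E.
  by rewrite -ig; apply: eq_integral => x _; rewrite gee0_abs// ltW.
move/(ae_eq_integral_abs P measurableT mg).1 => [N [mN PN0 gN]].
have : P [set: T] = 0%E.
  apply/eqP; rewrite eq_le measure_ge0 andbT -PN0 le_measure ?inE//.
  move=> x _; apply: gN => /= /(_ I) gx0.
  by have := g0 x; rewrite gx0 ltxx.
by move=> P0; have := @probability_setT _ _ _ P; rewrite P0 => /eqP; rewrite eq_sym onee_eq0.
Qed.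

(** Each pair of positions is counted once, the later entry being the first argument. The recursion
    matches a selection that puts each new sample at the head. *)
Fixpoint pair_sum (R : nmodType) (S : Type) (g : S -> S -> R) (s : seq S) : R :=
  if s is t :: s' then \sum_(u <- s') g u t + pair_sum R S g s' else 0.

Section small_pair_sum.
Context (R : realType) (d : measure_display) (S : measurableType d)
  (P : probability S R) (g : S * S -> R) (K : R).
Hypothesis mg : measurable_fun setT g.
Hypothesis g0 : forall st, 0 <= g st.
Hypothesis gK : (\int[P \x P]_st (g st)%:E <= K%:E)%E.

Let h (s : S) := (\int[P]_t (g (s, t))%:E)%E.

Let mgE : measurable_fun setT (fun st => (g st)%:E).
Proof. exact/measurable_EFinP. Qed.

Let gE0 st : (0 <= (g st)%:E)%E. Proof. by rewrite lee_fin. Qed.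

Let mh : measurable_fun setT h.
Proof. exact: (measurable_fun_fubini_tonelli_F _ mgE). Qed.

Let h0 s : (0 <= h s)%E. Proof. exact: integral_ge0. Qed.

Let hK : (\int[P]_s h s <= K%:E)%E.
Proof. by rewrite -(fubini_tonelli1 _ mgE gE0). Qed.

(* Derandomisation by conditional expectations: the potential bounded here is
   the expected pair sum after completing [s] with [n] further independent
   samples. *)
Lemma small_potential (k n : nat) : exists s : seq S, size s = k /\
  ((pair_sum R S (fun x y => g (x, y)) s)%:E +
   n%:R%:E * \sum_(u <- s) h u + ('C(n, 2)%:R * K)%:E
   <= ('C(n + k, 2)%:R * K)%:E)%E.
Proof.
elim: k n => [|k ih] n.
  by exists [::]; rewrite big_nil mule0 adde0 add0e addn0.
have [s [sk sK]] := ih n.+1.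
have H0 : (0 <= \sum_(u <- s) h u)%E by exact: sume_ge0.
(* The part of the potential that depends on the new sample [t]. Its mean is at most the sum of [h]
   over [s] plus [n * K], so some [t] does no worse. *)
pose f t := ((\sum_(u <- s) g (u, t))%:E + n%:R%:E * h t)%E.
have mgt u : measurable_fun setT (fun t => g (u, t)).
  by apply: measurableT_comp.
have mgs : measurable_fun setT (fun t => \sum_(u <- s) g (u, t)).
  exact: measurable_sum.
have [||t ft] := @exists_le_integral _ _ _ P f.
- by apply: emeasurable_funD; [exact/measurable_EFinP|exact: measurable_funeM].
- by move=> t; rewrite adde_ge0 ?mule_ge0// lee_fin sumr_ge0.
exists (t :: s); split; first by rewrite /= sk.
have {}ft : (f t <= \sum_(u <- s) h u + n%:R%:E * K%:E)%E.
  apply: (le_trans ft); rewrite ge0_integralD//; last 4 first.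
  - by move=> x _; rewrite lee_fin sumr_ge0.
  - exact/measurable_EFinP.
  - by move=> x _; rewrite mule_ge0.
  - exact: measurable_funeM.
  rewrite ge0_integralZl//.
  apply: leeD; last by rewrite lee_wpmul2l.
  under eq_integral do rewrite -sumEFin.
  rewrite ge0_integral_sum// => u.
  by apply/measurable_EFinP.
rewrite addnS; apply: le_trans sK.
(* The excess [n * K] is absorbed by ['C(n.+1, 2) = 'C(n, 2) + n], and the sum of [h] by the passage
   from [n.+1] to [n] remaining samples. *)
rewrite /= big_cons binS bin1 natrD mulrDl !EFinD ge0_muleDr//.
rewrite -natr1 EFinD ge0_muleDl ?lee_fin// mul1e -[X in (_ <= X)%E]addeA.
rewrite [leLHS](AC (2*2*1) ((1*3)*(2*4*5)))/=.
rewrite [leRHS](AC (1*(2*2)) ((3*5)*(1*2*4)))/=.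
by rewrite leeD2r.
Qed.


End small_pair_sum.

Lemma small_pair_sum (R : realType) (d : measure_display)
  (S : measurableType d) (P : probability S R) (g : S * S -> R) (K : R)
  (n : nat) :
  measurable_fun setT g -> (forall st, 0 <= g st) ->
  (\int[P \x P]_st (g st)%:E <= K%:E)%E ->
  exists s : seq S, size s = n /\
    pair_sum R S (fun x y => g (x, y)) s <= 'C(n, 2)%:R * K.
Proof.
move=> mg g0 gK.
have [s [sn sK]] := @small_potential _ _ _ P g K mg g0 gK n 0.
exists s; split=> //; move: sK.
by rewrite mul0e adde0 bin0n mul0r adde0 add0n lee_fin.
Qed.

Lemma sum_pair_sum (R : comNzRingType) (S : Type) (w : S -> S -> R)
  (s : seq S) : (forall x y, w x y = w y x) ->
  \sum_(x <- s) \sum_(y <- s) w x y =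
  \sum_(x <- s) w x x + 2 * pair_sum R S w s.
Proof.
move=> wC; elim: s => [|t s ih]; first by rewrite !big_nil mulr0 addr0.
rewrite /= !big_cons.
under [X in _ + X = _]eq_bigr do rewrite big_cons.
rewrite big_split/= ih (eq_bigr (fun x => w x t)) => [|x _]; last exact: wC.
by ring.
Qed.

Lemma le_pair_sum (R : numDomainType) (S : Type) (w w' : S -> S -> R)
  (s : seq S) : (forall x y, w x y <= w' x y) ->
  pair_sum R S w s <= pair_sum R S w' s.
Proof.
by move=> ww; elim: s => //= t s ih; rewrite lerD// ler_sum.
Qed.

(** * The chi-square distance as a second moment *)

(** The density [l] is a version of the likelihood ratio that is finite and nonnegative everywhere.
    It agrees with the one in [chi2] only almost everywhere, which suffices for the integrals; then
    [rho] is 1 plus the distance. *)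
Lemma density_second_moment (R : realType) (F0 F1 : probability R R) (r : R) :
  F1 `<< F0 -> (chi2 F0 F1 < r%:E)%E ->
  exists (l : R -> R) (rho : R),
    [/\ measurable_fun setT l, (forall y, 0 <= l y),
        (forall B, measurable B -> (\int[F0]_(y in B) (l y)%:E = F1 B)%E),
        (\int[F0]_y (l y ^+ 2)%:E = rho%:E)%E & 1 <= rho < 1 + r].
Proof.
move=> F10.
pose f := Radon_Nikodym_SigmaFinite.f F1 F0.
pose l y := fine (f y).
have fl y : f y = (l y)%:E.
  by rewrite fineK//; exact: Radon_Nikodym_SigmaFinite.f_fin_num.
have mf : measurable_fun setT f.
  by have /integrableP[] := Radon_Nikodym_SigmaFinite.f_integrable F10.
have ml : measurable_fun setT l.
  by apply/measurable_EFinP; rewrite (_ : EFin \o l = f)//; apply/funext => y /=.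
have l0 y : 0 <= l y.
  by rewrite -lee_fin -fl; exact: Radon_Nikodym_SigmaFinite.f_ge0.
have lE B : measurable B -> (\int[F0]_(y in B) (l y)%:E = F1 B)%E.
  move=> mB; rewrite (Radon_Nikodym_SigmaFinite.f_integral F10 mB).
  by apply: eq_integral => y _; rewrite -fl.
have l1 : (\int[F0]_y (l y)%:E = 1)%E by rewrite lE// probability_setT.
have mlX : measurable_fun setT (fun y => (l y - 1) ^+ 2).
  by apply: measurable_funX; exact: measurable_funB.
have chiE : chi2 F0 F1 = (\int[F0]_y ((l y - 1) ^+ 2)%:E)%E.
  rewrite /chi2 /likelihood_ratio.
  have RN := @ae_eq_Radon_Nikodym_SigmaFinite _ _ _ F1 F0 F10 setT measurableT.
  set L := Radon_Nikodym _ _ in RN *.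
  have mL : measurable_fun setT L.
    by have /integrableP[] :=
      @Radon_Nikodym_integrable _ _ _ (charge_of_finite_measure F1) F0 F10.
  have -> : (\int[F0]_y L y = 1)%E.
    rewrite -l1; apply: ae_eq_integral => //; first exact/measurable_EFinP.
    by apply: filterS RN => y /= /(_ I) <- _; exact: fl.
  apply: ae_eq_integral => //.
  - by apply: emeasurable_funM; exact: emeasurable_funB.
  - exact/measurable_EFinP.
  - apply: filterS RN => y /= /(_ I) <- _.
    by rewrite -/f fl -EFinB -EFinM expr2.
(* Expansion of [(l - 1) ^+ 2] without subtraction, so that it holds even for infinite integrals;
   finiteness of the distance then gives finiteness of the second moment. *)
have : (chi2 F0 F1 + 2%:E * 1 = \int[F0]_y (l y ^+ 2)%:E + 1)%E.
  rewrite chiE -[in LHS]l1 -ge0_integralZl//; last 2 first.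
  - exact/measurable_EFinP.
  - by move=> y _; rewrite lee_fin.
  rewrite -ge0_integralD//; last 4 first.
  - by move=> y _; rewrite lee_fin sqr_ge0.
  - exact/measurable_EFinP.
  - by move=> y _; rewrite -EFinM lee_fin mulr_ge0.
  - by apply/measurable_EFinP; exact: measurable_funM.
  transitivity (\int[F0]_y ((l y ^+ 2)%:E + 1))%E.
    by apply: eq_integral => y _; rewrite -EFinM -!EFinD; congr (_%:E); ring.
  rewrite ge0_integralD//.
  - by rewrite integral_cst//= probability_setT mul1e.
  - by move=> y _; rewrite lee_fin sqr_ge0.
  - by apply/measurable_EFinP; exact: measurable_funX.
have chi0 : (0 <= chi2 F0 F1)%E.
  by rewrite chiE; apply: integral_ge0 => y _; rewrite lee_fin sqr_ge0.
case: (chi2 F0 F1) chi0 => // c c0 cE; rewrite lte_fin => cr; move: cE.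
case sE: (\int[F0]_y (l y ^+ 2)%:E)%E => [s| |] //.
rewrite mule1 -!EFinD => -[cs].
exists l, s; split => //; move: c0; rewrite lee_fin => c0.
by apply/andP; split; lra.
Qed.

(** * The truncated overlap weight of two paths *)

Section intersection_weight.
Context (R : realType) (V : Type) (d : measure_display) (S : measurableType d)
  (path : S -> nat -> V) (P : probability S R).

Lemma common_geW (p q : nat -> V) (j k : nat) : (j <= k)%N ->
  common_ge p q k -> common_ge p q j.
Proof.
move=> jk [s [sk us sc]]; exists (take j s); split.
- by rewrite size_takel// sk.
- by move: us; rewrite -{1}(cat_take_drop j s) => /List.NoDup_app_remove_r.
- move=> v vs; apply: sc; rewrite -(cat_take_drop j s).
  by apply/List.in_or_app; left.
Qed.

(* [rho ^ min(N, m)], where [N] is the number of common vertices of the two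
   infinite paths, as a telescoping sum over the events known to be measurable. *)
Definition weight (rho : R) (m : nat) (st : S * S) : R :=
  1 + \sum_(k < m) (rho - 1) * rho ^+ k *
    \1_[set st : S * S | common_ge (path st.1) (path st.2) k.+1] st.

(** The first [k] increments telescope to [rho ^+ k - 1], as having [k] common vertices entails
    having any smaller number; the other increments are nonnegative. *)
Lemma weight_ge (rho : R) (m k : nat) (s t : S) : 1 <= rho -> (k <= m)%N ->
  common_ge (path s) (path t) k -> rho ^+ k <= weight rho m (s, t).
Proof.
move=> rho1 km stk.
have rho0 : 0 <= rho by lra.
rewrite -[leLHS](subrK 1) addrC lerD2l subrX1 mulr_sumr.
rewrite (big_ord_widen _ (fun i => (rho - 1) * rho ^+ i) km) big_mkcond.
apply: ler_sum => i _; case: ifP => ik.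
  rewrite indicE mem_set ?mulr1//=.
  exact: common_geW stk.
by rewrite mulr_ge0// mulr_ge0 ?subr_ge0// exprn_ge0.
Qed.

Lemma measurable_weight (rho : R) (m : nat) :
  (forall k, (1 <= k)%N ->
     measurable [set st : S * S | common_ge (path st.1) (path st.2) k]) ->
  measurable_fun setT (weight rho m).
Proof.
move=> mA; apply: measurable_funD => //; apply: measurable_sum => k.
by apply: measurable_funM => //; apply: measurable_indic; exact: mA.
Qed.

Lemma weight_ge0 (rho : R) (m : nat) (st : S * S) :
  1 <= rho -> 0 <= weight rho m st.
Proof.
move=> rho1; rewrite addr_ge0// sumr_ge0// => k _.
by rewrite mulr_ge0// mulr_ge0 ?subr_ge0// exprn_ge0//; lra.
Qed.

(** The tail bound turns the expected increments into a geometric series of ratio [rho * eta < 1],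
    whose sum bounds them uniformly in [m]. *)
Lemma integral_weight_le (rho eta C : R) (m : nat) :
  1 <= rho -> 0 < eta -> rho * eta < 1 -> 0 <= C ->
  (forall k, (1 <= k)%N ->
     let A := [set st : S * S | common_ge (path st.1) (path st.2) k] in
     measurable A /\ ((P \x P)%E A <= (C * eta ^+ k)%:E)%E) ->
  (\int[P \x P]_st (weight rho m st)%:E <=
   (1 + (rho - 1) * C * eta / (1 - rho * eta))%:E)%E.
Proof.
move=> rho1 eta0 re C0 tail.
have rho0 : 0 <= rho by lra.
have c0 k : 0 <= (rho - 1) * rho ^+ k.
  by rewrite mulr_ge0 ?subr_ge0// exprn_ge0.
pose A k := [set st : S * S | common_ge (path st.1) (path st.2) k.+1].
have mA k : measurable (A k) by exact: (tail k.+1 isT).1.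
have mcA k : measurable_fun setT
    (fun st => ((rho - 1) * rho ^+ k * \1_(A k) st)%:E).
  by apply/measurable_EFinP; apply: measurable_funM.
under eq_integral do rewrite EFinD -sumEFin.
rewrite ge0_integralD//; last 2 first.
- by move=> st _; apply: sume_ge0 => k _; rewrite lee_fin mulr_ge0.
- by apply: emeasurable_sum => k; exact: mcA.
rewrite integral_cst//= probability_setT mul1e.
rewrite EFinD leeD2l//.
rewrite ge0_integral_sum//; last first.
  by move=> k st _; rewrite lee_fin mulr_ge0.
apply: (@le_trans _ _ (\sum_(k < m)
    ((rho - 1) * C * eta * (rho * eta) ^+ k)%:E)%E).
  apply: lee_sum => k _.
  under eq_integral do rewrite EFinM.
  rewrite ge0_integralZl ?lee_fin//; last first.
    by apply/measurable_EFinP; apply: measurable_indic; exact: mA.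
  rewrite integral_indic//=; last exact: mA.
  rewrite setIT.
  apply: (le_trans (lee_wpmul2l _ (tail k.+1 isT).2)); first by rewrite lee_fin.
  rewrite -EFinM lee_fin exprMn exprS le_eqVlt; apply/orP; left; apply/eqP.
  by ring.
rewrite sumEFin lee_fin -mulr_sumr; apply: ler_wpM2l.
  by rewrite !mulr_ge0 ?subr_ge0// ltW.
rewrite -[leRHS]mul1r ler_pdivlMr ?subr_gt0// mulrC.
have := subrX1 (rho * eta) m; set q := rho * eta in re *.
have : 0 <= q ^+ m by rewrite exprn_ge0// mulr_ge0// ltW.
by set sm := \sum_(i < m) _ => *; lra.
Qed.

End intersection_weight.

(** * Initial segments of infinite paths, and the contradiction *)

Lemma In_mem (T : eqType) (x : T) (s : seq T) : List.In x s <-> x \in s.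
Proof.
elim: s => //= a s ih; rewrite inE; split.
  by move=> [->|/ih ->]; rewrite ?eqxx ?orbT.
by move=> /orP[/eqP ->|/ih]; [left|right].
Qed.

Lemma NoDup_uniq (T : eqType) (s : seq T) : List.NoDup s <-> uniq s.
Proof.
elim: s => [|a s ih] /=; first by split => // _; exact: List.NoDup_nil.
rewrite List.NoDup_cons_iff ih In_mem; split.
  by move=> [/negP -> ->].
by move=> /andP[/negP].
Qed.

Lemma indep_with_laws_uniq (R : realType) (V : eqType) (d : measure_display)
  (Om : measurableType d) (P : probability Om R) (X : V -> Om -> R)
  (F : V -> probability R R) : indep_with_laws P X F ->
  forall (s : seq V) (B : V -> set R), uniq s -> (forall v, measurable (B v)) ->
  P (\bigcap_(v in [set` s]) (X v @^-1` B v)) =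
  (\prod_(v <- s) fine (F v (B v)))%:E.
Proof.
move=> XF s B us mB; rewrite -XF//; last exact/NoDup_uniq.
congr (P _); congr (\bigcap_(v in _) _).
by apply/seteqP; split=> v /= /In_mem.
Qed.

Lemma count_mem_sym (T : eqType) (p q : seq T) : uniq p -> uniq q ->
  count [in q] p = count [in p] q.
Proof.
move=> up uq; rewrite -!size_filter; apply/perm_size/uniq_perm.
- exact: filter_uniq.
- exact: filter_uniq.
- by move=> v; rewrite !mem_filter andbC.
Qed.

Lemma common_ge_mkseq (T : eqType) (p q : nat -> T) (m : nat) : injective p ->
  common_ge p q (count [in mkseq q m] (mkseq p m)).
Proof.
move=> ip; exists [seq v <- mkseq p m | v \in mkseq q m]; split.
- by rewrite size_filter.
- by apply/NoDup_uniq/filter_uniq; rewrite mkseq_uniq.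
- move=> v /In_mem; rewrite mem_filter => /andP[/mapP[j _ vj] /mapP[i _ vi]].
  by split; [exists i|exists j].
Qed.

Lemma saw_mkseq (V : Type) (E : V -> V -> Prop) (o : V) (p : nat -> V)
  (m : nat) : inf_saw E o p -> saw_m E o m (mkseq p m).
Proof.
move=> [p0 ip Ep]; split.
- by rewrite size_mkseq.
- by move=> m0; rewrite nth_mkseq.
- by apply/(@NoDup_uniq {classic V}); rewrite mkseq_uniq.
- move=> i; rewrite size_mkseq => im.
  by rewrite !nth_mkseq//; exact: ltnW.
Qed.

(** The diagonal is [n * rho ^+ m], at most [n ^+ 2] by the choice of [n]; the rest is twice a pair
    sum, at most [2 * 'C(n, 2) * K] and so at most [n ^+ 2 * K]. *)
Lemma sum_overlap_le (R : realType) (V : eqType) (d : measure_display)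
  (S : measurableType d) (path : S -> nat -> V) (P : probability S R)
  (rho K : R) (m n : nat) :
  (forall s, injective (path s)) ->
  (forall k, (1 <= k)%N ->
     measurable [set st : S * S | common_ge (path st.1) (path st.2) k]) ->
  1 <= rho -> 0 <= K -> rho ^+ m <= n%:R ->
  (\int[P \x P]_st (weight R V d S path rho m st)%:E <= K%:E)%E ->
  exists s : seq S, size s = n /\
    \sum_(x <- s) \sum_(y <- s)
      rho ^+ count [in mkseq (path y) m] (mkseq (path x) m) <=
    n%:R ^+ 2 * (1 + K).
Proof.
move=> ip mA rho1 K0 rhon gK.
have rho0 : 0 <= rho by lra.
have [s [sn sK]] := @small_pair_sum _ _ _ P _ K n
  (@measurable_weight _ _ _ _ path rho m mA)
  (fun st => @weight_ge0 _ _ _ _ path rho m st rho1) gK.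
exists s; split => //.
have up x : uniq (mkseq (path x) m) by rewrite mkseq_uniq.
rewrite sum_pair_sum => [|x y]; last by rewrite count_mem_sym.
have -> : \sum_(x <- s) rho ^+ count [in mkseq (path x) m] (mkseq (path x) m) =
    n%:R * rho ^+ m.
  rewrite (eq_bigr (fun=> rho ^+ m)) => [|x _].
    by rewrite big_const_seq count_predT sn iter_addr_0 mulr_natl.
  congr (_ ^+ _); rewrite -[RHS](size_mkseq (path x)); apply/eqP.
  by rewrite -all_count; apply/allP.
have ww : pair_sum R S (fun x y =>
    rho ^+ count [in mkseq (path y) m] (mkseq (path x) m)) s <= 'C(n, 2)%:R * K.
  apply: le_trans sK; apply: le_pair_sum => x y; apply: weight_ge => //.
    by rewrite (leq_trans (count_size _ _))// size_mkseq.
  exact: common_ge_mkseq.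
have bn : 2 * 'C(n, 2)%:R <= n%:R ^+ 2 :> R.
  rewrite -natrX -natrM ler_nat bin2 mul2n.
  apply: (@leq_trans (n * n.-1)); last by rewrite leq_mul2l leq_pred orbT.
  by rewrite -{2}(odd_double_half (n * n.-1)) leq_addl.
have := ler_wpM2r K0 bn; have := ler_wpM2l (ler0n R n) rhon.
by rewrite -expr2 mulrDr mulr1 -mulrA; lra.
Qed.

Theorem theorem5p3 (R : realType) (V : Type) (E : V -> V -> Prop) (o : V)
  (F0 F1 : probability R R)
  (dS : measure_display) (S : measurableType dS) (path : S -> nat -> V)
  (pi : probability S R) (eta : R) :
  graph_connected E o ->
  F1 `<< F0 ->
  (forall s, inf_saw E o (path s)) ->
  0 < eta < 1 ->
  exp_intersection_tail path pi eta ->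
  (chi2 F0 F1 < (eta^-1 - 1)%:E)%E ->
  forall (dO : measure_display) (Om : measurableType dO) (X : V -> Om -> R)
    (P0 : probability Om R) (P1 : seq V -> probability Om R),
  (forall v, measurable_fun setT (X v)) ->
  indep_with_laws P0 X (fun _ => F0) ->
  (forall m p, saw_m E o m p ->
     indep_with_laws (P1 p) X (fun v => if `[< List.In v p >] then F1 else F0)) ->
  ~ exists T : nat -> Om -> bool,
      (forall m, is_test X (T m)) /\
      (fun m => risk E o P0 P1 m (T m)) @ \oo --> 0%E.
Proof.
move=> _ F10 saw /andP[eta0 eta1] [C [C0 tail]] chi dO Om X P0 P1 mX XF0 XF1.
move=> [T [testT riskT]].
have [l [rho [ml l0 lE l2 /andP[rho1 rho_lt]]]] :=
  @density_second_moment _ _ _ _ F10 chi.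
have re : rho * eta < 1 by rewrite -ltr_pdivlMr// mul1r; lra.
have rho0 : 0 <= rho by lra.
pose K := 1 + (rho - 1) * C * eta / (1 - rho * eta).
have K0 : 0 <= K.
  by rewrite addr_ge0// divr_ge0 ?mulr_ge0 ?subr_ge0// ltW.
pose M := 1 + K; have M0 : 0 < M by rewrite /M; lra.
(* Chosen so that [(M + 1) * eps = 1 / 2]; the final comparison needs this product to be below
   [3 / 4]. *)
pose eps := (2 * (M + 1))^-1.
have eps0 : 0 < eps by rewrite invr_gt0; lra.
have nb : nbhs (0 : \bar R) [set x | (x < eps%:E)%E].
  apply: open_nbhs_nbhs; split; first exact: open_ereal_lt_ereal.
  by rewrite /= lte_fin.
(* A single [m] with risk below [eps] is enough for the contradiction. *)
have [m _ /(_ m (leqnn m))/=] := riskT _ nb.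
rewrite /risk => risk_lt.
pose V' : eqType := {classic V}.
pose p (s : S) : seq V' := mkseq (path s) m.
have sp s : saw_m E o m (p s) by exact: saw_mkseq.
have up s : uniq (p s) by apply/NoDup_uniq; have [] := sp s.
set A := T m @^-1` [set true] in risk_lt.
have AC : T m @^-1` [set false] = ~` A.
  by apply/seteqP; split=> x; rewrite /A /=; case: (T m x).
have XF0' := @indep_with_laws_uniq R V' _ _ P0 X (fun=> F0) XF0.
have P1E s : measurable A /\ P1 (p s) A =
    (\int[P0]_(x in A) (\prod_(v <- p s) l (X v x))%:E)%E.
  apply: (@likelihood_sigmaX R V' _ _ P0 (P1 (p s)) X F0 F1 (p s) l) => //;
    last exact: testT.
  apply: (@indep_with_laws_uniq R V').
  have := XF1 m (p s) (sp s); congr (indep_with_laws _ _ _).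
  apply/funext => v; congr (if _ then _ else _).
  by apply/asboolP/idP => /(@In_mem V').
(* Applied to the zero function only to get a point of [S]: with at least one path, the supremum in
   the risk is nonnegative. *)
have [s0 _] := @exists_le_integral _ _ _ pi (cst 0%E)
  (@measurable_cst _ _ _ _ _ _) (fun=> lexx _).
have [mA _] := P1E s0.
have P1AC s : (P1 (p s) (~` A) <= ereal_sup
    [set P1 p (T m @^-1` [set false]) | p in saw_m E o m])%E.
  by apply: ereal_sup_ubound; exists (p s); rewrite ?AC.
have P0A : (P0 A <= eps%:E)%E.
  apply: le_trans (ltW risk_lt); rewrite leeDl//.
  exact: le_trans (P1AC s0).
have P1A s : ((1 - eps)%:E <= P1 (p s) A)%E.
  have : (P1 (p s) (~` A) <= eps%:E)%E.
    apply: le_trans (ltW risk_lt); apply: (le_trans (P1AC s)).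
    by rewrite leeDr.
  rewrite probability_setC// -(fineK (fin_num_measure (P1 (p s)) _ mA)).
  by rewrite -(EFinB 1) !lee_fin; lra.
(* Enough paths to make the diagonal harmless; the successor makes [n] positive. *)
pose n := (Num.bound (rho ^+ m)).+1.
have n0 : 0 < n%:R :> R by rewrite ltr0n.
have rhon : rho ^+ m <= n%:R.
  apply/ltW/(lt_le_trans (archi_boundP _)); first exact: exprn_ge0.
  by rewrite ler_nat.
have [s [sn sM]] := @sum_overlap_le R V' dS S path pi rho K m n
  (fun s => let: And3 _ ip _ := saw s in ip) (fun k k1 => (tail k k1).1)
  rho1 K0 rhon
  (@integral_weight_le R V' dS S path pi rho eta C m rho1 eta0 re (ltW C0) tail).
(* With [a = 2 * M * n], the linear term is [n * M * P0 A] and the quadratic one, given a double sum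
   of at most [n ^+ 2 * M], is at most [n / 4]. *)
have a0 : 0 < 2 * M * n%:R by rewrite !mulr_gt0.
have l1 : (\int[F0]_y (l y)%:E = 1)%E by rewrite lE// probability_setT.
have := @sum_integral_likelihood_le R V' _ _ P0 X F0 l rho mX XF0' ml l0 l1 l2
  A [seq p x | x <- s] (2 * M * n%:R) mA a0.
rewrite all_map (eq_all (a2 := predT)) ?all_predT; last first.
  by move=> x /=; rewrite up.
move=> /(_ isT); apply/negP; rewrite -ltNge.
rewrite !big_map (eq_bigr (fun x => P1 (p x) A)) => [|x _]; last first.
  by rewrite (P1E x).2.
under [X in (_^-1 * X)%:E]eq_bigr do rewrite big_map.
apply: (@lt_le_trans _ _ (n%:R * (1 - eps))%:E); last first.
  have -> : (n%:R * (1 - eps))%:E = (\sum_(x <- s) (1 - eps)%:E)%E.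
    by rewrite sumEFin big_const_seq count_predT sn iter_addr_0 mulr_natl.
  by apply: lee_sum => x _.
have [r rE] : exists r, P0 A = r%:E.
  by exists (fine (P0 A)); rewrite fineK ?fin_num_measure.
move: P0A; rewrite rE lee_fin -EFinM -EFinD lte_fin => r_le.
set D := \sum_(x <- s) _ in sM *.
have Meps : (M + 1) * eps = 1 / 2 by rewrite /eps; field; lra.
have -> : 2 * M * n%:R / 2 * r = n%:R * (M * r) by field.
have Mr : M * r <= M * eps by rewrite ler_wpM2l// ltW.
have D_le : (2 * (2 * M * n%:R))^-1 * D <= n%:R * (1 / 4).
  rewrite mulrC ler_pdivrMr ?mulr_gt0//; apply: (le_trans sM).
  by rewrite le_eqVlt -/M; apply/orP; left; apply/eqP; field.
apply: (le_lt_trans (lerD (ler_wpM2l (ltW n0) Mr) D_le)).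
by rewrite -mulrDr ltr_pM2l//; lra.
Qed.
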